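(* Let $p_r(n)$ denote Ramanujan's general partition function, defined for integers $n\ge 0$ and nonzero integers $r$ by $\sum_{n=0}^\infty p_r(n)q^n=\frac{1}{(q;q)_\infty^r}$ for $|q|<1$, where $(q;q)_\infty=\prod_{k=1}^\infty(1-q^{k})$. For any integer $\lambda$, every integer $n\ge 0$, and $\ell\in\{1,2,3,4\}$, we have $p_{-(25\lambda+2)}(25n+5\ell+2)\equiv 0\pmod 5$. *)

(* Defs.v *)
From HB Require Import structures.
From mathcomp Require Import all_boot all_order all_algebra.
From mathcomp Require Import complex.
From mathcomp Require Import all_classical all_reals all_analysis.
Set Implicit Arguments.
Unset Strict Implicit.
Unset Printing Implicit Defensive.
Import Order.TTheory GRing.Theory Num.Theory.
Import numFieldNormedType.Exports.
Local Open Scope classical_set_scope.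
Local Open Scope ring_scope.

(* The topology is only inferred on the carrier of an abstract numFieldType,
   so the definitions are over such a [C]; they are meant for [C := R[i]]
   with [R : realType], i.e. for the complex numbers. *)

(* (q; q)_oo; the limit exists when [`|q| < 1] and [C] is complete. *)
Definition qpoch_inf (C : numFieldType) (q : C) : C :=
  lim (\prod_(1 <= k < N.+1) (1 - q ^+ k) @[N --> \oo]).

(* [p r n] is p_r(n). On the complex numbers the generating function
   determines [p r n] for every nonzero [r]; [p 0] is unconstrained.
   The exponent [r] is an [int], so [_ ^ r] is [exprz], a negative [r]
   giving a power of the inverse. *)
Definition is_general_partition_function
    (C : numFieldType) (p : int -> nat -> int) : Prop :=
  forall r : int, r != 0 -> forall q : C, `|q| < 1 ->
    series (fun n : nat => (p r n)%:~R * q ^+ n) @ \oo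
      --> 1 / qpoch_inf q ^ r.

(* Main.v *)
(** Write [E] for Euler's product (q; q)_oo. For small real [q], the series of
    p_r equals [E ^ (- r)] up to O(q^K) for every [K], and such expansions
    determine integer coefficients; this turns the hypothesis into a congruence
    of polynomials. Modulo 5, [E(q) ^ 25 = E(q ^ 25)], and multiplying or dividing
    by a series in [q ^ 25] with constant term 1 preserves the vanishing of the
    coefficients in a residue class mod 25, so only [E ^ 2] matters. By the
    pentagonal number theorem its coefficient at [m] is the sum of
    [(-1) ^ (i + j)] over the integers [i], [j] with
    [(6 i + 1) ^ 2 + (6 j + 1) ^ 2 = 24 m + 2]. For [m = 25 n + 5 l + 2] the right
    side is divisible by 5 but not by 25, and conjugating the Gaussian integer
    [(6 i + 1) + (6 j + 1) sqrt(-1)] and multiplying it by [(3 - 4 sqrt(-1)) / 5],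
    or doing so after swapping [i] and [j], gives an involution on these pairs that
    changes the sign: the coefficient is 0. *)
Require Import Defs.
From mathcomp Require Import all_boot all_order all_algebra.
From mathcomp Require Import complex.
From mathcomp Require Import all_classical all_reals all_analysis.
From mathcomp Require Import zify ring lra.
Set Implicit Arguments.
Unset Strict Implicit.
Unset Printing Implicit Defensive.
Import Order.TTheory GRing.Theory Num.Theory.
Import numFieldNormedType.Exports.
Local Open Scope classical_set_scope.
Local Open Scope ring_scope.

(** * Euler's pentagonal number theorem in truncated form *)

Definition euler_poly (R : comNzRingType) (n : nat) : {poly R} :=
  \prod_(1 <= k < n.+1) (1 - 'X^k).

(* The terms of Shanks' finite form of Euler's pentagonal number theorem: their
   sum over [s <= n] is a partial pentagonal sum, the [s = 0] term is the product
   of the [1 - X^k] for [k <= n], and all the others are divisible by X^(n+1). *)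
Definition shanks_term (n s : nat) : {poly int} :=
  (-1) ^+ s * (\prod_(s.+1 <= k < n.+1) (1 - 'X^k)) * 'X^(s * n + 'C(s.+1, 2)).

(** The differences between the terms for [n.+1] and [n] telescope through [T]; the two monomials
    left over have the pentagonal exponents of index [-(n+1)] and [n+1]. *)
Lemma shanks_sumS n :
  \sum_(0 <= s < n.+2) shanks_term n.+1 s = \sum_(0 <= s < n.+1) shanks_term n s
    + (-1) ^+ n.+1 * ('X^(n.+1 * n + 'C(n.+2, 2)) + 'X^(n.+1 * n.+1 + 'C(n.+2, 2))).
Proof.
pose T s : {poly int} := (-1) ^+ s * (\prod_(s <= k < n.+1) (1 - 'X^k))
    * 'X^(s * n + 'C(s.+1, 2)).
have T0 : T 0%N = 0.
  by rewrite /T big_nat_recl //= expr0 subrr mul0r mulr0 mul0r.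
have Tn : T n.+1 = (-1) ^+ n.+1 * 'X^(n.+1 * n + 'C(n.+2, 2)).
  by rewrite /T big_geq // mulr1.
have step s : (s < n.+1)%N -> shanks_term n.+1 s = shanks_term n s + (T s.+1 - T s).
  move=> sn; rewrite /shanks_term /T (big_nat_recr n.+1) //=.
  rewrite (big_ltn sn).
  set P := \prod_(s.+1 <= k < n.+1) _.
  have -> : (s * n.+1 + 'C(s.+1, 2) = s * n + 'C(s.+1, 2) + s)%N by lia.
  have -> : (s.+1 * n + 'C(s.+2, 2) = s * n + 'C(s.+1, 2) + s + n.+1)%N.
    by rewrite (binS s.+1) bin1; lia.
  rewrite !exprD; move: ('X^_) => Y; rewrite exprSr; ring.
rewrite big_nat_recr //=.
rewrite (eq_big_nat _ _ (F2 := fun s => shanks_term n s + (T s.+1 - T s))); last first.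
  by move=> s /andP[_ ?]; exact: step.
rewrite big_split /= telescope_sumr // T0 Tn subr0 -addrA; congr (_ + _).
by rewrite /shanks_term big_geq // mulr1 mulrDr.
Qed.

Lemma mul2_bin2 n : (2 * 'C(n.+1, 2) = n.+1 * n)%N.
Proof. by elim: n => // n IHn; rewrite binS bin1; lia. Qed.

(** The generalized pentagonal number i(3i+1)/2, in a form without division. *)
Definition pent (i : int) : nat :=
  match i with
  | Posz n => 3 * 'C(n, 2) + 2 * n
  | Negz n => 3 * 'C(n.+1, 2) + n.+1
  end.

Lemma pentE i : 2 * (pent i)%:Z = i * (3 * i + 1).
Proof.
case: i => [[|n]|n] //=; have := mul2_bin2 n; rewrite ?NegzE; first nia.
by nia.
Qed.

Lemma leq_abs_pent i : (`|i| <= pent i)%N.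
Proof. by case: i => n; rewrite /pent; lia. Qed.

(** Built outwards, so that each step adds exactly the two indices produced by [shanks_sumS]. *)
Fixpoint int_interval (n : nat) : seq int :=
  if n is n'.+1 then [:: Posz n'.+1, Negz n' & int_interval n'] else [:: 0].

Lemma mem_int_interval n i : (i \in int_interval n) = (`|i| <= n)%N.
Proof.
elim: n => [|n IHn] /=; rewrite !inE; first by lia.
by rewrite IHn; lia.
Qed.

Lemma uniq_int_interval n : uniq (int_interval n).
Proof.
elim: n => //= n ->; rewrite inE !mem_int_interval; lia.
Qed.

Definition pent_sum n : {poly int} :=
  \sum_(i <- int_interval n) (-1) ^+ `|i|%N * 'X^(pent i).

Lemma pent_sum_shanks n : pent_sum n = \sum_(0 <= s < n.+1) shanks_term n s.
Proof.
elim: n => [|n IHn].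
  rewrite /pent_sum /shanks_term big_seq1 big_nat1 /= big_geq // !mul1r.
  by [].
rewrite shanks_sumS -IHn /pent_sum /= !big_cons addrA addrC; congr (_ + _).
rewrite /= -mulrDr addrC; congr (_ * (_ + _)); congr ('X^_);
  have := mul2_bin2 n; rewrite (binS n.+1) bin1; lia.
Qed.

Lemma euler_poly_pent_sum n :
  exists Q, euler_poly int n = pent_sum n + Q * 'X^(n.+1).
Proof.
(* These are the terms with [s >= 1], with X^(n+1) divided out of each. *)
exists (- \sum_(1 <= s < n.+1) (-1) ^+ s
  * (\prod_(s.+1 <= k < n.+1) (1 - 'X^k)) * 'X^(s.-1 * n + ('C(s.+1, 2)).-1)).
rewrite pent_sum_shanks big_ltn // mulNr mulr_suml.
rewrite [X in _ = _ - X](eq_big_nat _ _ (F2 := shanks_term n)) ?addrK.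
  by rewrite /shanks_term mul0n mul1r mulr1.
move=> [//|s] _; rewrite /shanks_term -[LHS]mulrA -exprD; congr (_ * 'X^_).
have : (0 < 'C(s.+2, 2))%N by rewrite bin_gt0.
by case: ('C(_, _)) => //= c _; lia.
Qed.

(** * Coefficients of the square of Euler's product *)

Lemma coef_euler_poly_sqr n m : (m <= n)%N ->
  (euler_poly int n ^+ 2)`_m =
  \sum_(x <- [seq (i, j) | i <- int_interval n, j <- int_interval n]
        | (pent x.1 + pent x.2 == m)%N) (-1) ^+ (`|x.1| + `|x.2|).
Proof.
move=> mn; have [Q ->] := euler_poly_pent_sum n.
have -> : (pent_sum n + Q * 'X^(n.+1)) ^+ 2
  = pent_sum n ^+ 2 + (2 * pent_sum n * Q + Q ^+ 2 * 'X^(n.+1)) * 'X^(n.+1) by ring.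
rewrite coefD coefMXn ltnS mn addr0 big_mkcond big_allpairs expr2.
rewrite /pent_sum mulr_suml coef_sum; apply: eq_bigr => i _.
rewrite mulr_sumr coef_sum; apply: eq_bigr => j _ /=.
rewrite mulrACA -!exprD -polyC1 -polyCN -polyC_exp coefCM coefXn eq_sym.
by case: eqP; rewrite ?mulr1 ?mulr0.
Qed.

Lemma sum_sign_involution0 (T : eqType) (s : seq T) (phi : T -> T) (F : T -> int) :
    uniq s -> {in s, forall x, phi x \in s} -> {in s, cancel phi phi} ->
    {in s, forall x, F (phi x) = - F x} -> \sum_(x <- s) F x = 0.
Proof.
move=> us sphi phiK Fphi.
have ps : perm_eq (map phi s) s.
  apply: uniq_perm => //.
    by rewrite map_inj_in_uniq // => x y xs ys /(congr1 phi); rewrite !phiK.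
  move=> x; apply/mapP/idP => [[y ys ->]|xs]; first exact: sphi.
  by exists (phi x); rewrite ?phiK ?sphi.
have : \sum_(x <- s) F x = - \sum_(x <- s) F x.
  rewrite -{1}(perm_big _ ps) /= big_map -sumrN big_seq [RHS]big_seq.
  exact: eq_bigr.
lia.
Qed.

(* With [z = (6 i + 1) + (6 j + 1) sqrt(-1)], this is the isometry
   [z |-> conj z * (3 - 4 sqrt(-1)) / 5], which is integral when [j = 2 i + 1]
   mod 5; here [k = (j - 2 i - 1) / 5]. *)
Definition reflect5 (x : int * int) : int * int :=
  let k := ((x.2 - 2 * x.1 - 1) %/ 5)%Z in
  (- x.1 - 1 - 4 * k, - 2 * x.1 - 1 - 3 * k).

Definition in_line5 (x : int * int) : bool := (5 %| x.2 - 2 * x.1 - 1)%Z.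

Lemma in_line5P x : in_line5 x ->
  exists2 k, x.2 = 2 * x.1 + 1 + 5 * k
    & reflect5 x = (- x.1 - 1 - 4 * k, - 2 * x.1 - 1 - 3 * k).
Proof.
by move=> x5; exists ((x.2 - 2 * x.1 - 1) %/ 5)%Z => //; move: x5; rewrite /in_line5; lia.
Qed.

(** The image has the same [k], which is also why [reflect5] is an involution here. *)
Lemma in_line5_reflect5 x : in_line5 x -> in_line5 (reflect5 x).
Proof. by case/in_line5P=> k xk ->; rewrite /in_line5 /=; lia. Qed.

Lemma reflect5K x : in_line5 x -> reflect5 (reflect5 x) = x.
Proof.
move=> x5; have /in_line5P[l] := in_line5_reflect5 x5.
case/in_line5P: x5 => k xk -> /= lk ->; case: x xk lk => i j /= xk lk.
by congr (_, _); lia.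
Qed.

(** As 24 [pent i] + 1 = (6i+1)^2, this is the invariance of the norm under an isometry. *)
Lemma pent_reflect5 x : in_line5 x ->
  (pent (reflect5 x).1 + pent (reflect5 x).2 = pent x.1 + pent x.2)%N.
Proof.
case/in_line5P=> k xk -> /=.
have := pentE x.2; have := pentE x.1; rewrite xk.
have := pentE (- x.1 - 1 - 4 * k); have := pentE (- 2 * x.1 - 1 - 3 * k).
nia.
Qed.

(** The coordinates of [x] and of its image add up to -1 - 2k, which is odd. *)
Lemma sign_reflect5 x : in_line5 x ->
  (-1) ^+ (`|(reflect5 x).1| + `|(reflect5 x).2|) = - (-1) ^+ (`|x.1| + `|x.2|) :> int.
Proof.
case/in_line5P=> k xk -> /=; rewrite xk -[LHS]signr_odd -[in RHS]signr_odd.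
rewrite -signrN; congr (_ ^+ _); congr nat_of_bool; lia.
Qed.

Lemma coef_euler_poly_sqr_eq0 N n l : (25 * n + 5 * l + 2 <= N)%N ->
  (0 < l < 5)%N -> (euler_poly int N ^+ 2)`_(25 * n + 5 * l + 2) = 0.
Proof.
move=> mN l5; rewrite coef_euler_poly_sqr // -big_filter.
set s := seq.filter _ _; set m := (25 * n + 5 * l + 2)%N in mN s *.
pose swap (x : int * int) := (x.2, x.1).
pose phi x := if in_line5 x then reflect5 x else swap (reflect5 (swap x)).
(* By [leq_abs_pent] the equation alone keeps both indices in the interval. *)
have sE x : (x \in s) = (pent x.1 + pent x.2 == m)%N.
  rewrite mem_filter andb_idr // => /eqP xm; case: x xm => i j /= xm.
  rewrite allpairs_f // mem_int_interval; 
    [have := leq_abs_pent i|have := leq_abs_pent j]; lia.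
(* Put a = 6i+1 and b = 6j+1. As 5 divides a^2 + b^2 = 24m+2, either b = 2a or a = 2b mod 5; both
   together would make a and b divisible by 5, hence 24m+2 divisible by 25, which 0 < l < 5
   excludes. *)
have line x : x \in s -> in_line5 (swap x) = ~~ in_line5 x.
  rewrite sE => /eqP; case: x => i j /= xm; rewrite /in_line5 /=.
  have := pentE i; have := pentE j; move: (pent i) (pent j) xm => u v xm.
  rewrite (divz_eq i 5) (divz_eq j 5).
  have := ltz_pmod i (isT : 0 < 5 :> int); have := ltz_pmod j (isT : 0 < 5 :> int).
  have := modz_ge0 i (isT : 5 != 0 :> int); have := modz_ge0 j (isT : 5 != 0 :> int).
  move: (i %/ 5)%Z (i %% 5)%Z (j %/ 5)%Z (j %% 5)%Z
    => a [[|[|[|[|[|b]]]]]|b] c [[|[|[|[|[|d]]]]]|d] //=;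
  move=> _ _ _ _ Ej Ei; rewrite /m in xm; lia.
  have swapK x : swap (swap x) = x by case: x.
have swap_s x : (swap x \in s) = (x \in s) by rewrite !sE addnC.
have reflect_s x : in_line5 x -> x \in s -> reflect5 x \in s.
  by move=> x5; rewrite !sE pent_reflect5.
apply: (@sum_sign_involution0 _ s phi).
- by rewrite filter_uniq // allpairs_uniq ?uniq_int_interval // => -[? ?] [].
- move=> x xs; move: (line x xs); rewrite /phi; case: (boolP (in_line5 x)) => x5 sx5.
    exact: reflect_s.
  by rewrite swap_s reflect_s ?sx5 ?swap_s.
- move=> x xs; move: (line x xs); rewrite /phi; case: (boolP (in_line5 x)) => x5 sx5.
    by rewrite in_line5_reflect5 // reflect5K.
  have ss : swap (reflect5 (swap x)) \in s.
    by rewrite swap_s reflect_s ?sx5 ?swap_s.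
  (* The swap of the image is on the line, so the image is not, and [phi] takes the same branch
     again. *)
  have := line _ ss; rewrite swapK in_line5_reflect5 ?sx5 // => /esym/negPf ->.
  by rewrite reflect5K ?sx5 // swapK.
- move=> x xs; move: (line x xs); rewrite /phi; case: (boolP (in_line5 x)) => x5 sx5.
    exact: sign_reflect5.
  by rewrite addnC [LHS]sign_reflect5 ?sx5 // addnC.
Qed.

(** * Frobenius powers and series in X^d *)

Lemma map_euler_poly (R S : comNzRingType) (f : {rmorphism R -> S}) n :
  map_poly f (euler_poly R n) = euler_poly S n.
Proof.
rewrite rmorph_prod; apply: eq_bigr => k _.
by rewrite rmorphB rmorph1 /= map_polyXn.
Qed.

Lemma coef0_euler_poly (R : comNzRingType) n : (euler_poly R n)`_0 = 1.
Proof.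
rewrite -horner_coef0 horner_prod big_nat big1 // => k /andP[k0 _].
by rewrite !hornerE expr0n; case: k k0 => //= k _; rewrite subr0.
Qed.

Lemma pFrobenius_euler_poly (R : comNzRingType) p n e : p \in [pchar R] ->
  euler_poly R n ^+ (p ^ e) = euler_poly R n \Po 'X^(p ^ e).
Proof.
move=> chRp; rewrite -prodrXl rmorph_prod; apply: eq_bigr => k _.
have chPp : p \in [pchar {poly R}] by rewrite pchar_poly.
have -> : (1 - 'X^k : {poly R}) ^+ (p ^ e) = 1 - 'X^k ^+ (p ^ e).
  elim: e => // e IHe; rewrite expnSr !(exprM _ (p ^ e) p) IHe -(pFrobenius_autE chPp).
  by rewrite rmorphB rmorph1 /= pFrobenius_autE.
by rewrite [RHS]rmorphB rmorph1 /= comp_Xn_poly -!exprM mulnC.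
Qed.

(** A factor in X^d only combines coefficients whose indices agree mod [d]. *)
Lemma coef_mul_comp_eq0 (R : comNzRingType) (d c K : nat) (A G : {poly R}) :
    (0 < d)%N ->
    (forall m, (m < K)%N -> m = c %[mod d] -> A`_m = 0) ->
  forall m, (m < K)%N -> m = c %[mod d] -> (A * (G \Po 'X^d))`_m = 0.
Proof.
move=> d0 A0 m mK mc; rewrite coefMr big1 // => i _.
rewrite coef_comp_poly_Xn //; case: ifP => di; last by rewrite mulr0.
rewrite A0 ?mul0r //; first by rewrite (leq_ltn_trans _ mK) // leq_subr.
rewrite -mc -[in RHS](subnK (ltn_ord i : (i <= m)%N)).
by rewrite -modnDmr (eqP di) addn0.
Qed.

(** Strong induction: since [G] has constant term 1, the coefficient of the product at [m] is that
    of [A] plus multiples of earlier ones in the same class. *)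
Lemma coef_div_comp_eq0 (R : comNzRingType) (d c K : nat) (A G : {poly R}) :
    (0 < d)%N -> G`_0 = 1 ->
    (forall m, (m < K)%N -> m = c %[mod d] -> (A * (G \Po 'X^d))`_m = 0) ->
  forall m, (m < K)%N -> m = c %[mod d] -> A`_m = 0.
Proof.
move=> d0 G0 AG0; elim/ltn_ind=> m IHm mK mc.
have := AG0 m mK mc; rewrite coefMr big_ord_recl subn0 big1 ?addr0.
  by rewrite coef_comp_poly_Xn // dvdn0 div0n G0 mulr1.
move=> i _; rewrite coef_comp_poly_Xn //=; case: ifP => di; last by rewrite mulr0.
have im : (bump 0 i <= m)%N by have := ltn_ord i; rewrite /bump; lia.
rewrite IHm ?mul0r //; first by rewrite /bump in im *; lia.
  by rewrite (leq_ltn_trans _ mK) // leq_subr.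
by rewrite -mc -[in RHS](subnK im) -modnDmr (eqP di) addn0.
Qed.

(** * Expansions at 0 along small positive reals *)

Lemma poly_bounded (R : numFieldType) (A : {poly R}) :
  exists2 D : R, 0 <= D & forall q, `|q| <= 1 -> `|A.[q]| <= D.
Proof.
elim/poly_ind: A => [|A c [D D0 AD]].
  by exists 0 => // q _; rewrite horner0 normr0.
exists (D + `|c|) => [|q q1]; first by rewrite addr_ge0.
rewrite !hornerE (le_trans (ler_normD _ _)) // lerD2r.
rewrite normrM -[leRHS]mulr1 ler_pM //; exact: AD.
Qed.

(* Only small positive real [q] are used, so that no complex analysis beyond the
   hypothesis of the theorem is needed: polynomials are already determined by
   their values there. *)
Definition taylor_at_0 (R : realFieldType) (K : nat) (f : R -> R) (A : {poly R}) : Prop :=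
  exists2 D, 0 <= D & forall q, 0 < q -> q <= 1 / 4 -> `|f q - A.[q]| <= D * q ^+ K.

Lemma taylor_at_0_ext (R : realFieldType) K (f g : R -> R) A :
  (forall q, 0 < q -> q <= 1 / 4 -> f q = g q) -> taylor_at_0 K f A -> taylor_at_0 K g A.
Proof. by move=> fg [D D0 fA]; exists D => // q q0 q4; rewrite -fg // fA. Qed.

Lemma taylor_at_0_1 (R : realFieldType) K : taylor_at_0 K (fun=> 1 : R) 1.
Proof. by exists 0 => // q _ _; rewrite hornerC subrr normr0 mul0r. Qed.

Lemma taylor_at_0M (R : realFieldType) K (f g : R -> R) A B :
  taylor_at_0 K f A -> taylor_at_0 K g B ->
  taylor_at_0 K (fun q => f q * g q) (A * B).
Proof.
move=> [D D0 fA] [E E0 gB].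
have [a a0 Aa] := poly_bounded A; have [b b0 Bb] := poly_bounded B.
exists (a * E + D * b + D * E) => [|q q0 q4]; first by rewrite !addr_ge0 // mulr_ge0.
have q1 : `|q| <= 1 by rewrite gtr0_norm //; lra.
have fAq := fA q q0 q4; have gBq := gB q q0 q4.
have qK0 : 0 <= q ^+ K by rewrite exprn_ge0 // ltW.
have qK1 : q ^+ K <= 1 by rewrite exprn_ile1 ?ltW //; lra.
have -> : f q * g q - (A * B).[q] = A.[q] * (g q - B.[q])
    + (f q - A.[q]) * B.[q] + (f q - A.[q]) * (g q - B.[q]).
  by rewrite hornerM; ring.
rewrite [leRHS]mulrDl [in leRHS]mulrDl; apply: (le_trans (ler_normD _ _)); apply: lerD.
  apply: (le_trans (ler_normD _ _)); apply: lerD; rewrite normrM.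
    by rewrite -mulrA ler_pM // Aa.
  by rewrite mulrAC ler_pM // Bb.
rewrite normrM -mulrA ler_pM // (le_trans fAq) // ler_piMr //.
Qed.

Lemma taylor_at_0X (R : realFieldType) K (f : R -> R) A n :
  taylor_at_0 K f A -> taylor_at_0 K (fun q => f q ^+ n) (A ^+ n).
Proof.
move=> fA; elim: n => [|n IHn]; first exact: taylor_at_0_1.
rewrite exprS; apply: taylor_at_0_ext (taylor_at_0M fA IHn) => q _ _.
by rewrite exprS.
Qed.

(** Induction on [K]: the bound on BX + c forces |c| = O(q), so c = 0, and dividing by q bounds B
    with the same [D]. *)
Lemma horner_bigO_eq0 (R : realFieldType) K (A : {poly R}) D : 0 <= D ->
  (forall q, 0 < q -> q <= 1 / 4 -> `|A.[q]| <= D * q ^+ K) ->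
  forall m, (m < K)%N -> A`_m = 0.
Proof.
move=> D0; elim: K A => // K IHK A; elim/poly_ind: A => [*|A c _ AD]; first by rewrite coef0.
have [a a0 Aa] := poly_bounded A.
have Dc q : 0 < q -> q <= 1 / 4 -> `|c| <= (D + a) * q.
  move=> q0 q4; have q1 : `|q| <= 1 by rewrite gtr0_norm //; lra.
  have := AD q q0 q4; rewrite !hornerE => ADq.
  rewrite -[c](addKr (A.[q] * q)) addrC (le_trans (ler_normB _ _)) // mulrDl lerD //.
    rewrite (le_trans ADq) // ler_wpM2l // exprS ler_piMr ?(ltW q0) //.
    by rewrite exprn_ile1 ?(ltW q0) //; lra.
  by rewrite normrM (gtr0_norm q0) ler_pM // ?Aa // ltW.
have c0 : c = 0.
  apply/eqP; rewrite -normr_eq0; apply/eqP; apply: le_anti; rewrite normr_ge0 andbT.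
  apply/ler_addgt0Pr => e e0; rewrite add0r.
  (* The added 1 keeps the denominator positive when [D] and [a] vanish. *)
  pose q := Num.min (1 / 4) (e / (D + a + 1)).
  have Da1 : 0 < D + a + 1 by lra.
  have q0 : 0 < q by rewrite lt_min; apply/andP; split; [lra | exact: divr_gt0].
  apply: (le_trans (Dc q q0 _)); first by rewrite ge_min lexx.
  rewrite (@le_trans _ _ ((D + a + 1) * q)) //; first by rewrite ler_pM2r //; lra.
  by rewrite mulrC -ler_pdivlMr // ge_min lexx orbT.
rewrite c0 addr0 in AD *; move=> [|m] mK; rewrite coefMX //=.
apply: IHK mK => q q0 q4; have := AD q q0 q4.
by rewrite hornerMX normrM (gtr0_norm q0) exprSr mulrA ler_pM2r.
Qed.

Lemma taylor_at_0_uniq (R : realFieldType) K (f : R -> R) A B m :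
  taylor_at_0 K f A -> taylor_at_0 K f B -> (m < K)%N -> A`_m = B`_m.
Proof.
move=> [D D0 fA] [E E0 fB] mK; apply/eqP; rewrite -subr_eq0 -coefB; apply/eqP.
apply: (@horner_bigO_eq0 _ K _ (D + E)) => // [|q q0 q4]; first by rewrite addr_ge0.
have -> : (A - B).[q] = (f q - B.[q]) - (f q - A.[q]) by rewrite !hornerE; ring.
by rewrite mulrDl [leRHS]addrC (le_trans (ler_normB _ _)) // lerD ?fA ?fB.
Qed.

(** The subtracted term is what lets the induction on [j] close. *)
Lemma geometric_tail_le (R : realFieldType) (x : R) m j : 0 <= x -> x <= 1 / 2 ->
  \sum_(m <= i < m + j) x ^+ i <= 2 * x ^+ m - 2 * x ^+ (m + j).
Proof.
move=> x0 x2; elim: j => [|j IHj]; first by rewrite addn0 big_geq // subrr.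
rewrite addnS big_nat_recr ?leq_addr //= (le_trans (lerD IHj (lexx _))) //.
by rewrite exprS; have := exprn_ge0 (m + j) x0; nra.
Qed.

(** Convergence at 1/2 gives |c n| <= B 2^n; for q <= 1/4 the tail is then dominated by a geometric
    series of ratio 2q <= 1/2. *)
Lemma taylor_at_0_series (R : realType) (c : nat -> R) (f : R -> R) K :
    (forall q, 0 < q -> q <= 1 / 2 -> series (fun n => c n * q ^+ n) @ \oo --> f q) ->
  taylor_at_0 K f (\poly_(i < K) c i).
Proof.
move=> cf; have h0 : 0 < 1 / 2 :> R by lra.
have /cvg_series_cvg_0 c0 : cvgn (series (fun n => c n * (1 / 2) ^+ n)).
  by apply/cvg_ex; exists (f (1 / 2)); exact: cf.
have [B B0 cB] : exists2 B, 0 <= B & forall n, `|c n| <= B * 2 ^+ n.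
  have /cvg_seq_bounded/pinfty_ex_gt0[B B0 cB] : cvgn (fun n => c n * (1 / 2) ^+ n).
    by apply/cvg_ex; exists 0.
  exists B => [|n]; first exact: ltW.
  have := cB n I; rewrite /= normrM normrX (gtr0_norm h0).
  by rewrite div1r exprVn ler_pdivrMr // exprn_gt0.
exists (2 * B * 2 ^+ K) => [|q q0 q4]; first by rewrite !mulr_ge0 // exprn_ge0.
have cq : (fun n => `|series (fun n => c n * q ^+ n) n - (\poly_(i < K) c i).[q]|) @ \oo
    --> `|f q - (\poly_(i < K) c i).[q]|.
  by apply: cvg_norm; apply: cvgB; [apply: cf => //; lra | exact: cvg_cst].
apply: (cvgr_to_le cq); exists K => // N /= KN.
rewrite /series /= horner_poly (@big_cat_nat _ _ _ K) //= big_mkord addrAC subrr add0r.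
rewrite (le_trans (ler_norm_sum _ _ _)) // -(subnKC KN).
apply: le_trans (_ : \sum_(K <= i < K + (N - K)) B * (2 * q) ^+ i <= _).
  apply: ler_sum => i _; rewrite normrM normrX (gtr0_norm q0) exprMn mulrA.
  by rewrite ler_wpM2r // exprn_ge0 // ltW.
have -> : 2 * B * 2 ^+ K * q ^+ K = B * (2 * (2 * q) ^+ K) by rewrite exprMn; ring.
rewrite -mulr_sumr ler_wpM2l //.
have q20 : 0 <= 2 * q by lra.
rewrite (le_trans (geometric_tail_le _ _ q20 _)) //; first by lra.
by have := exprn_ge0 (K + (N - K)) q20; lra.
Qed.

(** * Euler's infinite product at real points *)

Definition qpoch_partial (R : pzRingType) (q : R) (n : nat) : R :=
  \prod_(1 <= k < n.+1) (1 - q ^+ k).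

Lemma qpoch_partialS (R : pzRingType) (q : R) n :
  qpoch_partial q n.+1 = qpoch_partial q n * (1 - q ^+ n.+1).
Proof. by rewrite /qpoch_partial big_nat_recr. Qed.

Lemma qpoch_partial_ge0 (R : realFieldType) (q : R) n :
  0 < q -> q <= 1 / 2 -> 0 <= qpoch_partial q n.
Proof.
move=> q0 q2; apply: prodr_ge0 => k _.
by rewrite subr_ge0 exprn_ile1 ?(ltW q0) //; lra.
Qed.

Lemma qpoch_partial_noninc (R : realFieldType) (q : R) :
  0 < q -> q <= 1 / 2 -> nonincreasing_seq (qpoch_partial q).
Proof.
move=> q0 q2; apply/nonincreasing_seqP => n.
rewrite qpoch_partialS ler_piMr ?qpoch_partial_ge0 //.
by rewrite lerBlDr lerDl exprn_ge0 // ltW.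
Qed.

(** Partial products are at most 1, so the factor of index n lowers them by at most q^n; these
    losses are summed as a geometric tail. *)
Lemma qpoch_partial_lower (R : realFieldType) (q : R) m j : 0 < q -> q <= 1 / 2 ->
  qpoch_partial q m - 2 * q ^+ m.+1 + 2 * q ^+ (m + j).+1 <= qpoch_partial q (m + j).
Proof.
move=> q0 q2; elim: j => [|j IHj]; first by rewrite addn0 subrK.
have P1 : qpoch_partial q (m + j) <= 1.
  have := qpoch_partial_noninc q0 q2 (leq0n (m + j)).
  by rewrite [X in _ <= X]/qpoch_partial big_geq.
rewrite addnS qpoch_partialS [q ^+ (m + j).+2]exprS.
by have := exprn_ge0 (m + j).+1 (ltW q0); nra.
Qed.

Lemma cvg_qpoch_partial (R : realType) (q : R) :
  0 < q -> q <= 1 / 2 -> cvgn (qpoch_partial q).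
Proof.
move=> q0 q2; apply: nonincreasing_is_cvgn; first exact: qpoch_partial_noninc.
by exists 0 => _ [n _ <-]; exact: qpoch_partial_ge0.
Qed.

Lemma lim_qpoch_partial_bounds (R : realType) (q : R) m : 0 < q -> q <= 1 / 2 ->
  qpoch_partial q m - 2 * q ^+ m.+1 <= limn (qpoch_partial q) <= qpoch_partial q m.
Proof.
move=> q0 q2; apply/andP; split.
  apply: limr_ge; first exact: cvg_qpoch_partial.
  exists m => // n /= mn; have := qpoch_partial_lower m (n - m) q0 q2.
  by rewrite subnKC //; have := exprn_ge0 n.+1 (ltW q0); lra.
apply: limr_le; first exact: cvg_qpoch_partial.
by exists m => // n /= mn; exact: qpoch_partial_noninc.
Qed.

Lemma taylor_at_0_qpoch (R : realType) K :
  taylor_at_0 K.+1 (fun q : R => limn (qpoch_partial q)) (euler_poly R K).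
Proof.
exists 2 => // q q0 q4; have q2 : q <= 1 / 2 by lra.
have -> : (euler_poly R K).[q] = qpoch_partial q K.
  by rewrite horner_prod; apply: eq_bigr => k _; rewrite !hornerE.
have /andP[lo hi] := lim_qpoch_partial_bounds K q0 q2.
by rewrite ler0_norm; lra.
Qed.

Lemma lim_qpoch_neq0 (R : realType) (q : R) : 0 < q -> q <= 1 / 4 ->
  limn (qpoch_partial q) != 0.
Proof.
move=> q0 q4; have q2 : q <= 1 / 2 by lra.
(* At index 0 the lower bound is 1 - 2q, which is positive for q <= 1/4. *)
have /andP[+ _] := lim_qpoch_partial_bounds 0 q0 q2.
by rewrite /qpoch_partial big_geq // expr1 => lo; apply/lt0r_neq0; lra.
Qed.

(** * Descent of convergence from the complex numbers to the reals *)

Lemma cvg_rmorph_norm (R : realType) (C : numFieldType) (f : {rmorphism R -> C})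
    (u : nat -> R) (l : R) :
    (forall x, `|f x| = f `|x|) ->
    (forall e : C, 0 < e -> exists2 d : R, 0 < d & f d <= e) ->
  f (u n) @[n --> \oo] --> f l <-> u n @[n --> \oo] --> l.
Proof.
move=> f_norm f_small.
(* A positive [y - x] is its own norm, so [f] sends it to the norm of a nonzero element. *)
have f_lt x y : x < y -> f x < f y.
  move=> xy; rewrite -subr_gt0 -rmorphB -[y - x]gtr0_norm ?subr_gt0 // -f_norm.
  by rewrite normr_gt0 fmorph_eq0 subr_eq0 gt_eqF.
have f_ltE x y : (f x < f y) = (x < y).
  apply/idP/idP => [|/f_lt //]; apply: contraTT; rewrite -leNgt le_eqVlt.
  by case/predU1P => [->|/f_lt/lt_gtF ->] //; rewrite ltxx.
have f_gt0 x : 0 < x -> 0 < f x by move=> /f_lt; rewrite rmorph0.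
split=> /cvgrPdist_lt ul; apply/cvgrPdist_lt => e e0.
  have [N _ ulN] := ul _ (f_gt0 _ e0); exists N => // n Nn.
  by have := ulN n Nn; rewrite /= -rmorphB f_norm f_ltE.
have [d d0 fde] := f_small e e0.
have [N _ ulN] := ul _ d0; exists N => // n Nn.
by rewrite /= -rmorphB f_norm (lt_le_trans _ fde) // f_ltE; exact: ulN.
Qed.

Lemma cvg_generating_function (R : realType) (C : numFieldType)
    (f : {rmorphism R -> C}) (p : int -> nat -> int) (r : int) (q : R) :
    (forall x, `|f x| = f `|x|) ->
    (forall e : C, 0 < e -> exists2 d : R, 0 < d & f d <= e) ->
    is_general_partition_function C p -> r != 0 -> 0 < q -> q <= 1 / 2 ->
  series (fun n => (p r n)%:~R * q ^+ n) @ \oo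
    --> 1 / limn (qpoch_partial q) ^ r.
Proof.
move=> f_norm f_small hp r0 q0 q2.
have cvg_f := cvg_rmorph_norm _ _ f_norm f_small.
have fq1 : `|f q| < 1.
  rewrite f_norm gtr0_norm // -subr_gt0 -(rmorph1 f) -rmorphB.
  have q1 : 0 < 1 - q by lra.
  by rewrite -[1 - q]gtr0_norm // -f_norm normr_gt0 fmorph_eq0 gt_eqF.
have qpochE : qpoch_inf (f q) = f (limn (qpoch_partial q)).
  apply: cvg_lim; first exact: norm_hausdorff.
  have -> : (fun N => \prod_(1 <= k < N.+1) (1 - f q ^+ k)) = f \o qpoch_partial q.
    apply/funext => N /=; rewrite rmorph_prod; apply: eq_bigr => k _.
    by rewrite rmorphB rmorph1 rmorphXn.
  by apply/cvg_f; exact: cvg_qpoch_partial.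
apply/cvg_f; have := hp r r0 (f q) fq1.
have -> : series (fun n => (p r n)%:~R * f q ^+ n)
    = (fun N => f (series (fun n => (p r n)%:~R * q ^+ n) N)).
  apply/funext => N; rewrite /series /= rmorph_sum; apply: eq_bigr => k _.
  by rewrite rmorphM rmorph_int rmorphXn.
by rewrite qpochE -fmorphXz -(rmorph1 f) -fmorph_div.
Qed.

(** * Partition values as polynomial coefficients *)

Lemma taylor_at_0_partition (R : realType) (p : int -> nat -> int) (r : int) K :
  is_general_partition_function R[i]%C p -> r != 0 ->
  taylor_at_0 K (fun q : R => 1 / limn (qpoch_partial q) ^ r)
    (\poly_(i < K) (p r i)%:~R).
Proof.
move=> hp r0; apply: taylor_at_0_series => q q0 q2.
apply: (cvg_generating_function (f := real_complex R) _ _ hp r0 q0 q2).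
  by move=> x; rewrite normc_def /= expr0n /= addr0 sqrtr_sqr.
(* A positive complex number is a positive real, so its real part serves as [d]. *)
move=> e; rewrite ltcE /= => /andP[/eqP e0 eRe]; exists (complex.Re e) => //.
by rewrite lecE /= e0 eqxx lexx.
Qed.

(** Both polynomials expand the same function at 0, so their coefficients agree in [R], hence in
    [int]. *)
Lemma partition_neg_coef (R : realType) (p : int -> nat -> int) M N m :
  is_general_partition_function R[i]%C p -> (0 < M)%N -> (m <= N)%N ->
  p (- M%:Z) m = (euler_poly int N ^+ M)`_m.
Proof.
move=> hp M0 mN; apply: (@intr_inj R).
have r0 : - M%:Z != 0 by lia.
have := taylor_at_0_partition N.+1 hp r0.
move=> /(taylor_at_0_ext (g := fun q => limn (qpoch_partial q) ^+ M)) tp.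
have := taylor_at_0_uniq (tp _) (taylor_at_0X M (taylor_at_0_qpoch R N)) mN.
rewrite coef_poly ltnS mN -(map_euler_poly intr) -rmorphXn coef_map; apply=> q _ _.
by rewrite div1r -exprnN invrK.
Qed.

(** For a positive exponent the expansion is that of an inverse power of E, so the identity is
    stated as a product agreeing with 1 up to degree [N]. *)
Lemma partition_pos_coef (R : realType) (p : int -> nat -> int) (r N m : nat) :
  is_general_partition_function R[i]%C p -> (0 < r)%N -> (m <= N)%N ->
  ((\poly_(i < N.+1) p r i) * euler_poly int N ^+ r)`_m = (1 : {poly int})`_m.
Proof.
move=> hp r0 mN; apply: (@intr_inj R).
have r0z : r%:Z != 0 by lia.
have := taylor_at_0M (taylor_at_0_partition N.+1 hp r0z)
  (taylor_at_0X r (taylor_at_0_qpoch R N)).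
move=> /(taylor_at_0_ext (g := fun=> 1)) tp.
have := taylor_at_0_uniq (tp _) (taylor_at_0_1 R N.+1) mN.
rewrite -(map_euler_poly intr) -rmorphXn.
have -> : \poly_(i < N.+1) (p r i)%:~R = map_poly intr (\poly_(i < N.+1) p r i) :> {poly R}.
  by apply/polyP => i; rewrite coef_map !coef_poly; case: ifP.
have -> : 1 = map_poly intr 1 :> {poly R} by rewrite rmorph1.
rewrite -rmorphM !coef_map.
apply=> q q0 q4; rewrite div1r mulVf // expf_neq0 //; exact: lim_qpoch_neq0.
Qed.

(** * Reduction modulo 5 and conclusion *)

Lemma coef_euler_poly_sqr_F5 N l m : (0 < l < 5)%N -> (m < N.+1)%N ->
  m = 5 * l + 2 %[mod 25] -> (euler_poly 'F_5 N ^+ 2)`_m = 0.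
Proof.
move=> l5 mN mc; have mE : m = (25 * (m %/ 25) + 5 * l + 2)%N by lia.
rewrite -(map_euler_poly intr) -rmorphXn coef_map mE coef_euler_poly_sqr_eq0 //.
by rewrite -mE.
Qed.

Lemma euler_poly_F5_exp25 N k :
  euler_poly 'F_5 N ^+ (25 * k) = (euler_poly 'F_5 N ^+ k) \Po 'X^25.
Proof.
by rewrite exprM (@pFrobenius_euler_poly 'F_5 5 N 2) ?pchar_Fp // rmorphXn.
Qed.

Theorem theorem1p5 (R : realType) (p : int -> nat -> int)
    (hp : is_general_partition_function R[i]%C p)
    (lambda : int) (n l : nat) (hl : l \in [:: 1; 2; 3; 4]%N) :
  (p (- (25 * lambda + 2)) (25 * n + 5 * l + 2)%N = 0 %[mod 5])%Z.
Proof.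
have l5 : (0 < l < 5)%N by move: hl; rewrite !inE; lia.
set m := (25 * n + 5 * l + 2)%N.
have mc : m = 5 * l + 2 %[mod 25] by rewrite /m; lia.
apply/eqP; rewrite eqz_mod_dvd subr0 (dvdz_pcharf (pchar_Fp (isT : prime 5))).
case: lambda => k; apply/eqP.
  (* For nonnegative [lambda], E^2 is multiplied by a polynomial in X^25. *)
  have -> : - (25 * k%:Z + 2) = - (2 + 25 * k)%N%:Z by lia.
  rewrite (partition_neg_coef hp (N := m)) // -coef_map rmorphXn /= map_euler_poly.
  rewrite exprD euler_poly_F5_exp25.
  apply: (@coef_mul_comp_eq0 _ 25 (5 * l + 2) m.+1) => // i.
  exact: coef_euler_poly_sqr_F5.
(* Here [lambda] is -(k+1) and r = 25(k+1) - 2, so [A] times E^(25(k+1)) agrees with E^2 up to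
   degree [m], and E^(25(k+1)) is divided out. *)
have -> : - (25 * Negz k + 2) = (25 * k + 23)%N by lia.
set r := (25 * k + 23)%N.
pose A := map_poly (intr : int -> 'F_5) (\poly_(i < m.+1) p r i).
have -> : (p r m)%:~R = A`_m by rewrite coef_map coef_poly ltnSn.
have AE i : (i < m.+1)%N -> (A * euler_poly 'F_5 m ^+ r)`_i = (1 : {poly 'F_5})`_i.
  move=> im; rewrite -(map_euler_poly intr) -rmorphXn -rmorphM coef_map.
  by rewrite (partition_pos_coef hp) ?/r ?addn_gt0 ?orbT // !coef1; case: eqP.
apply: (@coef_div_comp_eq0 _ 25 (5 * l + 2) m.+1 A (euler_poly 'F_5 m ^+ k.+1)) => //.
  by rewrite -horner_coef0 horner_exp horner_coef0 coef0_euler_poly expr1n.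
move=> i im ic; rewrite -euler_poly_F5_exp25.
have -> : (25 * k.+1 = r + 2)%N by rewrite /r; lia.
(* Since [A] times E^r is known to be 1 only up to degree [m], it is replaced term by term in the
   convolution. *)
rewrite exprD mulrA coefM (eq_bigr (fun j : 'I_i.+1 =>
  (1 : {poly 'F_5})`_j * (euler_poly 'F_5 m ^+ 2)`_(i - j))).
  by rewrite -coefM mul1r (coef_euler_poly_sqr_F5 l5).
by move=> j _; rewrite AE //; exact: leq_trans im.
Qed.
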